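(* Every caterpillar of diameter $4$ with an even number of edges is super edge-graceful.
   Context: A caterpillar is a tree such that removing all its leaves (endpoints) leaves a path. For a finite simple graph $G$ with $p$ vertices and $q$ edges, $G$ is called super edge-graceful if there is a bijection $f$ from $E(G)$ onto $\{0,\pm1,\ldots,\pm\frac{q-1}{2}\}$ when $q$ is odd, and onto $\{\pm1,\ldots,\pm\frac{q}{2}\}$ when $q$ is even, such that the induced vertex labeling $f^+(v)=\sum_{uv\in E(G)} f(uv)$ is a bijection from $V(G)$ onto $\{0,\pm1,\ldots,\pm\frac{p-1}{2}\}$ when $p$ is odd, and onto $\{\pm1,\ldots,\pm\frac{p}{2}\}$ when $p$ is even. *)

(* Defs.v *)
From mathcomp Require Import all_boot all_order all_algebra.

Set Implicit Arguments.
Unset Strict Implicit.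
Unset Printing Implicit Defensive.

Import GRing.Theory.

(* A finite simple graph is a symmetric irreflexive relation e on a finType T;
   the theorem assumes both properties explicitly. *)
Section Graphs.

Variables (T : finType) (e : rel T).

Definition edges : {set {set T}} :=
  [set [set xy.1; xy.2] | xy : T * T & e xy.1 xy.2].

Definition degree (v : T) : nat := #|[set u | e v u]|.

Definition leaves : {set T} := [set v | degree v == 1].

(* The empty graph is not connected. *)
Definition connected : Prop :=
  0 < #|T| /\ forall x y : T, connect e x y.

(* ucycle also accepts sequences of length at most 2 (in particular the
   back-and-forth walk x, y, x), hence the size condition. *)
Definition acyclic : Prop :=
  forall c : seq T, 2 < size c -> ~ ucycle e c.

Definition is_tree : Prop := connected /\ acyclic.

(* Least length of a walk from x to y; two vertices in the same component are
   joined by a walk of length less than #|T|, and the value is #|T| for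
   vertices in different components. *)
Definition dist (x y : T) : nat :=
  find (fun n => [exists p : n.-tuple T, path e x p && (last x p == y)])
       (iota 0 #|T|).

Definition diameter : nat := \max_(xy : T * T) dist xy.1 xy.2.

(* The subgraph induced on A is a path: A can be listed without repetition so
   that adjacency within A is exactly being consecutive in the list. *)
Definition induces_path (A : {set T}) : Prop :=
  exists s : seq T,
    [/\ uniq s, s =i A &
        {in A &, forall x y,
           e x y = (index y s == (index x s).+1)
                || (index x s == (index y s).+1)}].

Definition caterpillar : Prop := is_tree /\ induces_path (~: leaves).

(* {0, ±1, ..., ±(n-1)/2} for n odd and {±1, ..., ±n/2} for n even. *)
Definition label_set (n : nat) : pred int :=
  fun z => if odd n then `|z|%N <= n.-1./2
           else (z != 0%R) && (`|z|%N <= n./2).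

Definition bijection_onto (S : finType) (A : {set S}) (f : S -> int)
    (B : pred int) : Prop :=
  {in A &, injective f} /\ [seq f x | x in A] =i B.

Definition induced_label (f : {set T} -> int) (v : T) : int :=
  (\sum_(u : T | e u v) f [set u; v])%R.

(* Only the values of f on edges matter. *)
Definition super_edge_graceful : Prop :=
  exists f : {set T} -> int,
    bijection_onto edges f (label_set #|edges|) /\
    bijection_onto [set: T] (induced_label f) (label_set #|T|).

End Graphs.

(* Main.v *)
(**
  A tree of diameter 4 whose non-leaves form a path is a spine c1 - c2 - c3 with
  all other vertices hanging from it.  Root it at c2 and let g give each vertex
  the label of the edge to its parent, with g c2 = 0.  The vertex labels are
  then g v at every leaf, so it is enough that the labels at c1, c2, c3 be a
  permutation of g c1, g c2, g c3.  Let l1, l2, l3 be the numbers of leaves at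
  c1, c2, c3; their sum is even.  Put opposite labels on
  - c1 and c3, if all l_i are even (vertex labels unchanged);
  - c1 and a leaf at c1, and c3 and a leaf at c2, if l1 and l2 are odd (the
    labels of c1 and c2 are exchanged);
  and if l1 and l3 are odd, put 1, -1 on c1, c3 and -2, 2 on a leaf at c1 and a
  leaf at c3 (the labels of c1 and c3 are exchanged).  The remaining leaves at
  each c_i are even in number and receive pairs of opposite labels.
*)
Require Import Defs.
From mathcomp Require Import all_boot all_order all_algebra all_fingroup.
From mathcomp Require Import zify.

Set Implicit Arguments.
Unset Strict Implicit.
Unset Printing Implicit Defensive.

(** * Walks in trees and the shape of a caterpillar of diameter 4 *)

Section Tree.

Variables (T : finType) (e : rel T).
Hypotheses (e_sym : symmetric e) (e_irr : irreflexive e).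

Lemma leaf_nbr_inj (v a b : T) : v \in leaves e -> e v a -> e v b -> a = b.
Proof.
rewrite inE => /cards1P[w nbr_v] va vb.
have: a \in [set u | e v u] by rewrite inE.
have: b \in [set u | e v u] by rewrite inE.
by rewrite nbr_v !inE => /eqP-> /eqP->.
Qed.

Lemma nonleafI (v a b : T) : e v a -> e v b -> a != b -> v \notin leaves e.
Proof.
move=> va vb ab; apply/negP=> v_l.
by rewrite (leaf_nbr_inj v_l va vb) eqxx in ab.
Qed.

Lemma nonleaf_other_nbr (v a : T) :
  v \notin leaves e -> e v a -> exists2 b, b != a & e v b.
Proof.
move=> v_nonleaf va.
case: (pickP [pred b | (b != a) && e v b]) => [b /andP[ba vb]|no_nbr].
  by exists b.
case/negP: v_nonleaf; rewrite inE; apply/cards1P; exists a.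
apply/setP=> b; rewrite !inE.
case: eqVneq (no_nbr b) => [->|ba] /=; first by rewrite va.
by rewrite ba.
Qed.

(** If the paths part at the first step, towards [y] and [z], their tails connect [y] to [z] in the
    graph [e'] without [x]. A simple path from [y] to [z] in [e'] closes up through [x] to a
    cycle. *)
Lemma acyclic_path_unique (x : T) (p q : seq T) :
  acyclic e -> path e x p -> path e x q -> uniq (x :: p) -> uniq (x :: q) ->
  last x p = last x q -> p = q.
Proof.
move=> acyc.
elim: p x q => [|y p IHp] x [|z q] //=.
- by move=> _ _ _ /andP[/negP x_zq _] xl; case: x_zq; rewrite xl mem_last.
- by move=> _ _ /andP[/negP x_yp _] _ xl; case: x_yp; rewrite -xl mem_last.
move=> /andP[xy yp] /andP[xz zq] /andP[x_yp y_p] /andP[x_zq z_q] yz_last.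
have [yz|y_neq_z] := eqVneq y z.
  by subst z; rewrite (IHp y q).
pose e' := [rel a b | [&& e a b, a != x & b != x]].
have e'_sym : connect_sym e'.
  by apply: sym_connect_sym => a b /=; rewrite e_sym [(a != x) && _]andbC.
have avoid w r : path e w r -> x \notin w :: r -> connect e' w (last w r).
  move=> wr x_wr; apply/connectP; exists r => //.
  elim: r w wr x_wr => //= u r IHr w /andP[wu ur].
  rewrite !inE !negb_or => /and3P[xw xu x_r].
  by rewrite wu eq_sym xw eq_sym xu IHr // inE negb_or xu.
have: connect e' y z.
  apply: connect_trans (avoid _ _ yp x_yp) _.
  by rewrite e'_sym yz_last; apply: avoid.
case/connectP=> r0 /shortenP[r yr uniq_r _] z_last.
case: (acyc [:: x, y & r]).
  by case: r z_last {yr uniq_r} => //= zy; rewrite zy eqxx in y_neq_z.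
have sub_e : subrel e' e by move=> a b /and3P[].
apply/andP; split.
  rewrite /= xy rcons_path (sub_path sub_e) //=.
  by rewrite -z_last e_sym.
rewrite cons_uniq uniq_r andbT inE negb_or.
move: x_yp; rewrite inE negb_or => /andP[-> _] /=.
elim: r {z_last uniq_r} y {xy y_neq_z yp y_p yz_last} yr => //= u r IHr w.
by case/andP=> /and3P[_ _ ux] /IHr; rewrite inE negb_or eq_sym ux.
Qed.

(** A local condition, settled on an explicit walk by a few inequalities; in an acyclic graph it
    already forces the walk to be simple. *)
Fixpoint non_backtracking (s : seq T) : bool :=
  if s is a :: s' then
    (if s' is _ :: c :: _ then a != c else true) && non_backtracking s'
  else true.

(** The tail is simple by induction, so a return to [x] cuts out a cycle; it has at least three
    vertices, since returning right after [y] would be backtracking. *)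
Lemma non_backtracking_uniq (x : T) (p : seq T) :
  acyclic e -> path e x p -> non_backtracking (x :: p) -> uniq (x :: p).
Proof.
move=> acyc; elim: p x => [|y p IHp] x //= /andP[xy yp] /andP[x_hd nb_yp].
have uniq_yp := IHp y yp nb_yp; rewrite [_ && uniq p]uniq_yp andbT.
apply/negP; rewrite inE => /predU1P[xx|x_p]; first by rewrite xx e_irr in xy.
have uniq_p : uniq (y :: p) by [].
case/splitPr: x_p x_hd yp uniq_p {IHp nb_yp uniq_yp} => [[|z p1] p2] /=.
  by rewrite eqxx.
rewrite cat_path /= => _ /and4P[yz zp1 p1x _] uniq_p.
apply: (acyc [:: x, y, z & p1]) => //.
rewrite /ucycle /= xy yz rcons_path zp1 p1x /=.
have: uniq ((y :: z :: p1) ++ x :: p2) by [].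
by rewrite -cat_rcons cat_uniq rcons_uniq => /andP[].
Qed.

Lemma dist_le (x : T) (p : seq T) : path e x p -> dist e x (last x p) <= size p.
Proof.
move=> xp; rewrite /dist; set P := fun n => _.
have Pp : P (size p) by apply/existsP; exists (in_tuple p); rewrite xp eqxx.
have [p_lt|] := ltnP (size p) #|T|; last first.
  by move=> le_p; rewrite (leq_trans (find_size _ _)) // size_iota.
rewrite leqNgt; apply/negP=> /(before_find 0).
by rewrite nth_iota // add0n Pp.
Qed.

Lemma dist_path (x y : T) :
  connect e x y -> exists p, [/\ path e x p, last x p = y & size p = dist e x y].
Proof.
case/connectP=> p0 /shortenP[p xp uniq_p _] y_last.
rewrite /dist; set P := (X in find X _).
have p_lt : size p < #|T| by have := max_card [in x :: p]; rewrite (card_uniqP uniq_p).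
have hasP' : has P (iota 0 #|T|).
  apply/hasP; exists (size p); first by rewrite mem_iota.
  by apply/existsP; exists (in_tuple p); rewrite xp y_last eqxx.
have := nth_find 0 hasP'.
rewrite has_find size_iota in hasP'.
rewrite nth_iota // add0n => /existsP[q /andP[xq /eqP last_q]].
by exists q; rewrite size_tuple.
Qed.

(** By uniqueness of simple paths, the walk is what remains after shortening a shortest walk between
    its ends, so its length is at most their distance. *)
Lemma diameter_ge (x : T) (p : seq T) :
  is_tree e -> path e x p -> non_backtracking (x :: p) -> size p <= diameter e.
Proof.
move=> [[_ conn] acyc] xp nb_p.
have [q0 [xq0 last_q0 size_q0]] := dist_path (conn x (last x p)).
have le_diam : dist e x (last x p) <= diameter e.
  by rewrite /diameter (bigD1 (x, last x p)) //= leq_maxl.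
apply: leq_trans le_diam; rewrite -size_q0.
move: last_q0; case/shortenP: xq0 {size_q0} => q xq uniq_q sub_q last_q.
have -> : p = q.
  by apply: (acyclic_path_unique acyc xp xq) => //; apply: non_backtracking_uniq.
apply: uniq_leq_size sub_q; by case/andP: uniq_q.
Qed.

(** The first vertex [u] after [v] on a simple path to [c] is either [c] or has both [v] and a later
    vertex as neighbours. *)
Lemma leaf_nbr_nonleaf (v c : T) :
  (forall x y, connect e x y) -> c \notin leaves e -> v \in leaves e ->
  exists2 u, u \notin leaves e & e v u.
Proof.
move=> conn c_nl v_l; case/connectP: (conn v c) => p0 /shortenP[p vp + _].
case: p vp => [_ _ /= cv|u p /=]; first by rewrite cv v_l in c_nl.
case/andP=> vu up /and3P[v_up _ _] c_last; exists u => //.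
case: p up v_up c_last => [_ _ /= <-|w p /= /andP[uw _] v_up _] //.
have vw : v != w by move: v_up; rewrite !inE !negb_or => /and3P[].
by apply: nonleafI _ uw vw; rewrite e_sym.
Qed.

(** Neighbours of [u] within [A] sit one place before or after [u] in the list, which leaves room
    for only two. *)
Lemma induced_path_degree_le2 (A : {set T}) (u a b c : T) :
  induces_path e A -> u \in A -> a \in A -> b \in A -> c \in A ->
  e u a -> e u b -> e u c -> uniq [:: a; b; c] -> False.
Proof.
move=> [s [uniq_s sA adj]] uA aA bA cA ua ub uc.
have ind_inj x y : x \in A -> y \in A -> index x s = index y s -> x = y.
  by move=> xA yA eq_xy; rewrite -(nth_index u (s := s) (x := x)) ?sA // eq_xy nth_index ?sA.
move: ua ub uc; rewrite !adj //=.
rewrite !inE negb_or => ua ub uc /and3P[/andP[ab ac] bc _].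
have nab : index a s <> index b s by move/(ind_inj _ _ aA bA)/eqP; rewrite (negPf ab).
have nac : index a s <> index c s by move/(ind_inj _ _ aA cA)/eqP; rewrite (negPf ac).
have nbc : index b s <> index c s by move/(ind_inj _ _ bA cA)/eqP; rewrite (negPf bc).
lia.
Qed.

(** The spine is the interior of a path [x - c1 - c2 - c3 - y] realising the diameter. A further
    non-leaf would give a walk of length 5 without backtracking, or a third non-leaf neighbour of
    [c2]. *)
Lemma caterpillar_diam4 :
  caterpillar e -> diameter e = 4 ->
  exists c1 c2 c3 : T,
    [/\ uniq [:: c1; c2; c3],
        [&& e c1 c2, e c2 c3 & ~~ e c1 c3],
        ~: leaves e =i [:: c1; c2; c3] &
        forall v, v \in leaves e -> exists2 u, u \in [:: c1; c2; c3] & e v u].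
Proof.
move=> [tree ind_path] diam4; have [[T0 conn] acyc] := tree.
have : 0 < #|{: T * T}| by rewrite card_prod muln_gt0 T0.
case/(eq_bigmax (fun xy : T * T => dist e xy.1 xy.2))=> [[x y] /=].
rewrite -/(diameter e) diam4 => dist_xy.
have [p [xp last_p]] := dist_path (conn x y); rewrite -dist_xy.
have no_short q : path e x q -> last x q = y -> 4 <= size q.
  by move=> xq last_q; have := dist_le xq; rewrite last_q -dist_xy.
case: p xp last_p => [|c1 [|c2 [|c3 [|y' [|? ?]]]]] //= + yE _.
subst y'; case/and5P=> xc1 c12 c23 c3y _.
(* Equal vertices two steps apart, or a chord [c1 - c3], would give a walk from [x] to [y] shorter
   than 4. *)
have x_c2 : x != c2.
  apply/eqP=> xE; have := no_short [:: c3; y]; rewrite /= xE c23 c3y.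
  by move/(_ isT erefl).
have c1_c3 : c1 != c3.
  apply/eqP=> cE; have := no_short [:: c1; y]; rewrite /= xc1 cE c3y.
  by move/(_ isT erefl).
have c2_y : c2 != y.
  apply/eqP=> yE; have := no_short [:: c1; c2]; rewrite /= xc1 c12.
  by move/(_ isT yE).
have c13 : ~~ e c1 c3.
  apply/negP=> c13; have := no_short [:: c1; c3; y]; rewrite /= xc1 c13 c3y.
  by move/(_ isT erefl).
have nl1 : c1 \notin leaves e by apply: nonleafI _ c12 x_c2; rewrite e_sym.
have nl2 : c2 \notin leaves e by apply: nonleafI _ c23 c1_c3; rewrite e_sym.
have nl3 : c3 \notin leaves e by apply: nonleafI _ c3y c2_y; rewrite e_sym.
have no5 a b c d f g : path e a [:: b; c; d; f; g] ->
    a != c -> b != d -> c != f -> d != g -> False.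
  move=> abcdfg ac bd cf dg; have := diameter_ge tree abcdfg.
  by rewrite diam4 /= ac bd cf dg => /(_ isT).
(* A path from c2 to a non-leaf off the spine, not starting with b, extends
   through a - b - c2 to a non-backtracking walk of length 5. *)
have far a b d t p : e a b -> e b c2 -> e c2 d -> a != c2 -> b != d ->
    b \notin leaves e -> d \notin leaves e ->
    t != b -> path e c2 (t :: p) -> uniq (c2 :: t :: p) ->
    last t p != d -> last t p \notin leaves e -> False.
  move=> ab bc2 c2d a_c2 b_d b_nl d_nl t_b.
  (* At length 1, [t] is a third non-leaf neighbour of [c2]; at length 2, the non-leaf end has one
     more neighbour [z]; from length 3 on, the first three steps suffice. *)
  case: p => [|t2 [|t3 p]] /=.
  - rewrite andbT => c2t _ t_d t_nl.
    apply: (induced_path_degree_le2 (u := c2) (a := b) (b := d) (c := t) ind_path);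
      rewrite ?in_setC // 1?e_sym //= !inE negb_or b_d eq_sym t_b.
    by rewrite eq_sym t_d.
  - rewrite andbT => /andP[c2t tt2] uniq_p _ t2_nl.
    have t2t : e t2 t by rewrite e_sym.
    have [z z_t t2z] := nonleaf_other_nbr t2_nl t2t.
    apply: (@no5 a b c2 t t2 z) => //=.
    + by rewrite ab bc2 c2t tt2 t2z.
    + by rewrite eq_sym.
    + by move: uniq_p; rewrite !inE negb_or => /andP[/andP[]].
    + by rewrite eq_sym.
  - case/and4P=> c2t tt2 t2t3 _ uniq_p _ _.
    apply: (@no5 a b c2 t t2 t3) => //=.
    + by rewrite ab bc2 c2t tt2 t2t3.
    + by rewrite eq_sym.
    + by move: uniq_p; rewrite !inE !negb_or => /andP[/and3P[]].
    + by move: uniq_p; rewrite !inE !negb_or => /and3P[_ /and3P[]].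
have nlE : ~: leaves e =i [:: c1; c2; c3].
  move=> w; rewrite in_setC.
  apply/idP/idP=> [w_nl|]; last by rewrite 2!in_cons mem_seq1 => /or3P[] /eqP->.
  apply/negP=> /negP; rewrite !inE !negb_or => /and3P[w_c1 w_c2 w_c3].
  case/connectP: (conn c2 w) => p0 /shortenP[[|t p] c2p uniq_p _] wE.
    by rewrite wE eqxx in w_c2.
  (* Reach [c2] from [y] through [c3] if the path starts with [c1], and from [x] through [c1]
     otherwise, to avoid backtracking at [c2]. *)
  rewrite /= in wE; have [tc1|t_c1] := eqVneq t c1.
    apply: (far y c3 c1 t p) => //; rewrite -?wE // 1?e_sym // 1?eq_sym //.
    by rewrite tc1 eq_sym.
  by apply: (far x c1 c3 t p) => //; rewrite -?wE.
exists c1, c2, c3; split=> //.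
- apply: non_backtracking_uniq => //=; first by rewrite c12 c23.
  by rewrite c1_c3.
- by rewrite c12 c23.
move=> v v_l; have [u u_nl vu] := leaf_nbr_nonleaf conn nl2 v_l.
by exists u => //; rewrite -nlE in_setC.
Qed.

End Tree.

Import GRing.Theory.

(** * Enumeration of the label set of even size *)

Section Zigzag.

Local Open Scope ring_scope.

(* 1, -1, 2, -2, ... *)
Definition zigzag (k : nat) : int :=
  if odd k then - (k./2.+1)%:Z else (k./2.+1)%:Z.

Lemma zigzag_inj : injective zigzag.
Proof. rewrite /zigzag => j k; case: ifP; case: ifP; lia. Qed.

Lemma zigzag_label (n k : nat) :
  ~~ odd n -> (k < n)%N -> zigzag k \in label_set n.
Proof.
move=> /negPf n_even k_n; rewrite unfold_in /label_set n_even /zigzag.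
case: ifP; lia.
Qed.

Lemma zigzag_onto (n : nat) (z : int) :
  ~~ odd n -> z \in label_set n -> exists2 k, (k < n)%N & z = zigzag k.
Proof.
move=> n_even; rewrite unfold_in /label_set (negPf n_even) => /andP[z0 z_n].
(* For m > 0, the label m has position 2(m-1), and -m has the next one. *)
exists ((`|z|%N).-1.*2 + (z < 0)%R)%N; first by case z_lt0: (z < 0); lia.
by rewrite /zigzag oddD odd_double /=; case z_lt0: (z < 0) => /=; lia.
Qed.

End Zigzag.

(** * Labelling vertices by their position in a list *)

Section PositionLabel.

Local Open Scope ring_scope.

Variable T : eqType.
Implicit Types (s : seq T) (v : T).

(** The default 0 is the label wanted at the root, the one vertex left off the list. *)
Definition position_label s v : int :=
  if v \in s then zigzag (index v s) else 0.

Lemma position_label_out s v : v \notin s -> position_label s v = 0.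
Proof. by rewrite /position_label => /negPf->. Qed.

Lemma position_label_mid s s1 s2 v :
  s = s1 ++ v :: s2 -> uniq s -> position_label s v = zigzag (size s1).
Proof.
move=> -> uniq_s; rewrite /position_label mem_cat mem_head orbT.
congr zigzag; rewrite -cat_rcons index_cat mem_rcons mem_head.
rewrite -cats1 index_cat /= eqxx addn0 ifN //.
by move: uniq_s; rewrite cat_uniq /= negb_or => /and3P[_ /andP[]].
Qed.

Lemma position_label_inj s : {in s &, injective (position_label s)}.
Proof.
move=> v w vs ws; rewrite /position_label vs ws => /zigzag_inj eq_index.
by rewrite -(nth_index v vs) eq_index nth_index.
Qed.

Lemma position_label_onto s (z : int) :
  uniq s -> ~~ odd (size s) ->
  reflect (exists2 v, v \in s & z = position_label s v)
          (z \in label_set (size s)).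
Proof.
move=> uniq_s s_even; apply: (iffP idP) => [z_lab|[v vs ->]]; last first.
  by rewrite /position_label vs zigzag_label // index_mem.
have [k k_lt ->] := zigzag_onto s_even z_lab.
case: s uniq_s k_lt {s_even z_lab} => // x s uniq_s k_lt.
exists (nth x (x :: s) k); first exact: mem_nth.
by rewrite /position_label mem_nth // index_uniq.
Qed.

(* An even block starting at an even position splits into consecutive pairs of
   opposite labels. *)
Lemma position_label_block s s1 s2 s3 :
  s = s1 ++ s2 ++ s3 -> uniq s -> ~~ odd (size s1) -> ~~ odd (size s2) ->
  \sum_(v <- s2) position_label s v = 0.
Proof.
have [n] := ubnP (size s2).
elim: n s1 s2 => // n IHn s1 [|a [|b s2]] //=; first by rewrite big_nil.
rewrite ltnS => s2_n sE uniq_s s1_even s2_even.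
rewrite !big_cons (IHn (s1 ++ [:: a; b]) s2) //; last first.
- by rewrite -(negbK (odd _)).
- by rewrite size_cat oddD addbF.
- by rewrite -catA.
- exact: ltnW.
rewrite (position_label_mid sE uniq_s).
rewrite (@position_label_mid s (rcons s1 a) (s2 ++ s3)) ?cat_rcons //.
rewrite size_rcons /zigzag /= (negPf s1_even) /= uphalf_half (negPf s1_even).
by rewrite addr0 subrr.
Qed.

End PositionLabel.

(** * Orderings of the non-root vertices that permute the spine labels *)

Section Balanced.

Local Open Scope ring_scope.

Variable T : finType.
Implicit Types (r c : T) (l : seq T).

(* c1, r, c3 is the spine and l1, l2, l3 are the leaves hanging from c1, r, c3;
   the sums are the labels induced on the spine when each edge receives the
   label of its end farther from r. *)
Definition balanced r c1 c3 l1 l2 l3 :=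
  exists (s : seq T) (sigma : {perm T}),
    perm_eq s (c1 :: c3 :: l1 ++ l2 ++ l3) /\
    let g := position_label s in
    [/\ g c1 + \sum_(v <- l1) g v = g (sigma c1),
        g c3 + \sum_(v <- l3) g v = g (sigma c3),
        g c1 + g c3 + \sum_(v <- l2) g v = g (sigma r) &
        forall v, v \notin [:: r; c1; c3] -> sigma v = v].

Lemma balanced_sym r c1 c3 l1 l2 l3 :
  balanced r c3 c1 l3 l2 l1 -> balanced r c1 c3 l1 l2 l3.
Proof.
case=> s [sigma [s_perm [sum3 sum1 sum2 sigma_id]]]; exists s, sigma; split.
  apply: (perm_trans s_perm).
  by apply/seq.permP=> P; rewrite /= !count_cat; lia.
split=> //=; first by rewrite [position_label s c1 + _]addrC.
by move=> v; rewrite !inE [(v == c1) || _]orbC => v_out; apply: sigma_id; rewrite !inE.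
Qed.

(** With [c1], [c3] labelled 1, -1 and every block of leaves summing to 0, the sums at [c1], [c3],
    [r] are 1, -1, 0, so the identity serves as [sigma]. *)
Lemma balanced_even r c1 c3 l1 l2 l3 :
  uniq [:: r, c1, c3 & l1 ++ l2 ++ l3] ->
  ~~ odd (size l1) -> ~~ odd (size l2) -> ~~ odd (size l3) ->
  balanced r c1 c3 l1 l2 l3.
Proof.
rewrite cons_uniq => /andP[r_s uniq_s] even1 even2 even3.
set s := (X in uniq X) in uniq_s r_s.
exists s, 1%g; split=> //=; rewrite !perm1.
have g1 := @position_label_mid _ s [::] _ c1 erefl uniq_s.
have g3 := @position_label_mid _ s [:: c1] _ c3 erefl uniq_s.
rewrite (@position_label_block _ s [:: c1; c3] l1 (l2 ++ l3)) //.
rewrite (@position_label_block _ s [:: c1, c3 & l1] l2 l3) //=; last first.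
  by rewrite negbK.
rewrite (@position_label_block _ s ([:: c1, c3 & l1] ++ l2) l3 [::]) //=.
- rewrite (position_label_out r_s) g1 g3 !addr0; split=> // v _.
  by rewrite perm1.
- by rewrite cats0 -catA.
- by rewrite negbK size_cat oddD (negPf even1).
Qed.

(** Label [c1], [x], [c3], [z] by 1, -1, 2, -2, where [x] and [z] head [l1] and [l2]. The sums at
    [c1], [c3], [r] are 0, 2 and 1 + 2 - 2 = 1, so [sigma] swaps [r] and [c1]. *)
Lemma balanced_odd_even r c1 c3 l1 l2 l3 :
  uniq [:: r, c1, c3 & l1 ++ l2 ++ l3] ->
  odd (size l1) -> odd (size l2) -> ~~ odd (size l3) ->
  balanced r c1 c3 l1 l2 l3.
Proof.
case: l1 => // x l1; case: l2 => // z l2.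
rewrite cons_uniq => /andP[r_s0 uniq_s0] /= even1 even2 even3.
pose s := [:: c1; x; c3; z] ++ l1 ++ l2 ++ l3.
have s_perm : perm_eq s [:: c1, c3 & (x :: l1) ++ (z :: l2) ++ l3].
  by apply/seq.permP=> P; rewrite /= !count_cat /= !count_cat; lia.
have uniq_s : uniq s by rewrite (perm_uniq s_perm).
have r_s : r \notin s by rewrite (perm_mem s_perm).
have g1 := @position_label_mid _ s [::] _ c1 erefl uniq_s.
have gx := @position_label_mid _ s [:: c1] _ x erefl uniq_s.
have g3 := @position_label_mid _ s [:: c1; x] _ c3 erefl uniq_s.
have gz := @position_label_mid _ s [:: c1; x; c3] _ z erefl uniq_s.
exists s, (tperm r c1); split=> //=; rewrite !big_cons tpermL tpermR.
rewrite (@position_label_block _ s [:: c1; x; c3; z] l1 (l2 ++ l3)) //.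
rewrite (@position_label_block _ s ([:: c1; x; c3; z] ++ l1) l2 l3) //=; last first.
  by rewrite !negbK.
rewrite (@position_label_block _ s (([:: c1; x; c3; z] ++ l1) ++ l2) l3 [::]) //=.
- rewrite (position_label_out r_s) g1 g3 gx gz !addr0; split=> //.
  + rewrite tpermD //.
    * by apply: contraNneq r_s0 => ->; rewrite !inE eqxx orbT.
    * by move: uniq_s0 => /andP[]; rewrite inE negb_or => /andP[].
  + move=> v; rewrite !inE !negb_or => /and3P[vr vc1 _].
    by rewrite tpermD // eq_sym.
- by rewrite cats0 -!catA.
- by rewrite !negbK size_cat oddD (negPf even1).
Qed.

(* With c1, c3, y, x labelled 1, -1, 2, -2 the labels of c1 and c3 are
   exchanged. *)
Lemma balanced_odd_odd r c1 c3 l1 l2 l3 :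
  uniq [:: r, c1, c3 & l1 ++ l2 ++ l3] ->
  odd (size l1) -> ~~ odd (size l2) -> odd (size l3) ->
  balanced r c1 c3 l1 l2 l3.
Proof.
case: l1 => // x l1; case: l3 => // y l3.
rewrite cons_uniq => /andP[r_s0 uniq_s0] /= even1 even2 even3.
pose s := [:: c1; c3; y; x] ++ l1 ++ l2 ++ l3.
have s_perm : perm_eq s [:: c1, c3 & (x :: l1) ++ l2 ++ (y :: l3)].
  by apply/seq.permP=> P; rewrite /= !count_cat /=; lia.
have uniq_s : uniq s by rewrite (perm_uniq s_perm).
have r_s : r \notin s by rewrite (perm_mem s_perm).
have g1 := @position_label_mid _ s [::] _ c1 erefl uniq_s.
have g3 := @position_label_mid _ s [:: c1] _ c3 erefl uniq_s.
have gy := @position_label_mid _ s [:: c1; c3] _ y erefl uniq_s.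
have gx := @position_label_mid _ s [:: c1; c3; y] _ x erefl uniq_s.
exists s, (tperm c1 c3); split=> //=; rewrite !big_cons tpermL tpermR.
rewrite (@position_label_block _ s [:: c1; c3; y; x] l1 (l2 ++ l3)) //.
rewrite (@position_label_block _ s ([:: c1; c3; y; x] ++ l1) l2 l3) //=; last first.
  by rewrite !negbK.
rewrite (@position_label_block _ s (([:: c1; c3; y; x] ++ l1) ++ l2) l3 [::]) //=.
- move: (r_s0); rewrite !inE !negb_or => /and3P[r_c1 r_c3 _].
  rewrite tpermD 1?eq_sym // (position_label_out r_s) g1 g3 gx gy !addr0.
  split=> // v; rewrite !inE !negb_or => /and3P[_ vc1 vc3].
  by rewrite tpermD // eq_sym.
- by rewrite cats0 -!catA.
- by rewrite !negbK size_cat oddD (negPf even1).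
Qed.

Lemma balanced_exists r c1 c3 l1 l2 l3 :
  uniq [:: r, c1, c3 & l1 ++ l2 ++ l3] -> ~~ odd (size (l1 ++ l2 ++ l3)) ->
  balanced r c1 c3 l1 l2 l3.
Proof.
move=> uniq_s; rewrite !size_cat !oddD.
case odd1: (odd (size l1)); case odd2: (odd (size l2));
  case odd3: (odd (size l3)) => //= _.
- by apply: balanced_odd_even; rewrite ?odd3.
- by apply: balanced_odd_odd; rewrite ?odd2.
(* [l2] and [l3] odd: reversing the spine reduces this to the first case. *)
- apply: balanced_sym; apply: balanced_odd_even; rewrite ?odd1 //.
  rewrite -(perm_uniq (s1 := [:: r, c1, c3 & l1 ++ l2 ++ l3])) //.
  by apply/seq.permP=> P; rewrite /= !count_cat; lia.
- by apply: balanced_even; rewrite ?odd1 ?odd2 ?odd3.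
Qed.

End Balanced.

(** * Graphs given by a parent map, with each edge labelled through its child *)

Section RootedTree.

Local Open Scope ring_scope.

Variables (T : finType) (e : rel T) (r : T) (par : T -> T).
Hypothesis eE : forall x y,
  e x y = (x != r) && (par x == y) || (y != r) && (par y == x).
Hypothesis par_par : forall v, v != r -> par v != r -> par (par v) != v.

(** Two different vertices sharing a parent edge would be each other's parent, against [par_par]. *)
Lemma parent_edge_inj : {in predC1 r &, injective (fun v => [set v; par v])}.
Proof.
move=> v w /= vr wr eq_vw.
have /set2P[//|v_pw] : v \in [set w; par w] by rewrite -eq_vw set21.
have /set2P[//|w_pv] : w \in [set v; par v] by rewrite eq_vw set21.
by have := par_par vr; rewrite -w_pv -v_pw eqxx => /(_ wr).
Qed.

Lemma edgesE : edges e = [set [set v; par v] | v in predC1 r].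
Proof.
apply/setP=> S; apply/imsetP/imsetP=> [[[x y] /=]|[v vr ->]].
  rewrite inE /= eE => /orP[] /andP[zr /eqP <-] ->; first by exists x.
  by exists y => //; rewrite setUC.
by exists (v, par v) => //; rewrite inE /= eE eqxx andbT; apply/orP; left.
Qed.

Lemma card_edges : #|edges e| = #|T|.-1.
Proof. by rewrite edgesE (card_in_imset parent_edge_inj) cardC1. Qed.

Variable g : T -> int.

(** A sum replaces the choice of a child: by [parent_edge_inj] it has a single term when [S] is an
    edge. *)
Definition edge_of_child (S : {set T}) : int :=
  \sum_(v | (v != r) && (S == [set v; par v])) g v.

Lemma edge_of_childE v : v != r -> edge_of_child [set v; par v] = g v.
Proof.
move=> vr; rewrite /edge_of_child (big_pred1 v) // => w /=.
apply/andP/eqP=> [[wr /eqP eq_wv]|->]; last by [].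
by apply: parent_edge_inj.
Qed.

Hypothesis gr : g r = 0.

(** The edge to the parent contributes [g v] and the edge to a child [u] contributes [g u]; at the
    root, [gr] makes up for the missing parent. *)
Lemma induced_label_child v :
  induced_label e edge_of_child v =
  g v + \sum_(u | (u != r) && (par u == v)) g u.
Proof.
rewrite /induced_label (bigID (fun u => (v != r) && (par v == u))) /=.
congr (_ + _).
  have [->|vr] := eqVneq v r; first by rewrite big_pred0 ?gr // => u; rewrite andbF.
  rewrite (big_pred1 (par v)) => [|u /=]; first by rewrite setUC edge_of_childE.
  by rewrite eE vr /= [u == par v]eq_sym; case: (par v == u); rewrite ?orbT ?andbF.
rewrite (eq_bigl (fun u => (u != r) && (par u == v))) => [|u].
  by apply: eq_bigr => u /andP[ur /eqP <-]; rewrite edge_of_childE.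
rewrite eE; case: (boolP (_ && (par v == u))) => [/andP[vr /eqP <-]|]; last by rewrite orbF andbT.
rewrite andbF; apply/esym/negbTE/negP=> /andP[pvr /eqP ppv].
by have := par_par vr pvr; rewrite ppv eqxx.
Qed.

(** The values of [g] off the root are exactly the edge labels, and the root adds 0. The induced
    labelling is [g] composed with the permutation [sigma], so it has the same values, each taken
    once. *)
Lemma rooted_super_edge_graceful (s : seq T) (sigma : {perm T}) :
  ~~ odd #|edges e| -> perm_eq s (enum (predC1 r)) ->
  g =1 position_label s ->
  (forall v, g v + \sum_(u | (u != r) && (par u == v)) g u = g (sigma v)) ->
  super_edge_graceful e.
Proof.
move=> edges_even s_perm gE g_sigma.
have uniq_s : uniq s by rewrite (perm_uniq s_perm) enum_uniq.
have mem_s v : (v \in s) = (v != r) by rewrite (perm_mem s_perm) mem_enum.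
have size_s : size s = #|edges e|.
  by rewrite card_edges (perm_size s_perm) -cardE cardC1.
have s_even : ~~ odd (size s) by rewrite size_s.
have gP z := position_label_onto z uniq_s s_even.
(* Here p = q + 1 is odd and (p-1)/2 = q/2, so only 0 is new. *)
have labelT z : (z \in label_set #|T|) = (z == 0) || (z \in label_set (size s)).
  have -> : #|T| = (size s).+1.
    by rewrite size_s card_edges prednK //; apply/card_gt0P; exists r.
  rewrite !unfold_in /label_set /= s_even (negPf s_even).
  by case: eqVneq => [->|].
have g_inj : injective g.
  have g_neq0 v : v != r -> g v != 0.
    move=> vr; suff : g v \in label_set (size s).
      by rewrite unfold_in /label_set (negPf s_even) => /andP[].
    by apply/gP; exists v; rewrite ?mem_s ?gE.
  move=> v w; have [->|vr] := eqVneq v r; have [->|wr] := eqVneq w r => // eq_g.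
  - by have := g_neq0 w wr; rewrite -eq_g gr eqxx.
  - by have := g_neq0 v vr; rewrite eq_g gr eqxx.
  - by apply: (@position_label_inj _ s); rewrite ?mem_s // -!gE.
exists edge_of_child; split; split.
- rewrite edgesE => S S' /imsetP[v vr ->] /imsetP[w wr ->].
  by rewrite !edge_of_childE // => /g_inj->.
- move=> z; rewrite -size_s; apply/imageP/gP=> [[S + ->]|[v]].
    rewrite edgesE => /imsetP[v vr ->]; exists v; first by rewrite mem_s.
    by rewrite edge_of_childE.
  rewrite mem_s -gE => vr ->; exists [set v; par v].
    by rewrite edgesE; apply/imsetP; exists v.
  by rewrite edge_of_childE.
- move=> v w _ _; rewrite !induced_label_child !g_sigma => /g_inj.
  exact: perm_inj.
move=> z; rewrite labelT; apply/imageP/orP=> [[v _ ->]|].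
  rewrite induced_label_child g_sigma; set w := sigma v.
  have [->|wr] := eqVneq w r; first by left; rewrite gr.
  by right; apply/gP; exists w; rewrite ?mem_s.
have onto w : exists2 v, v \in [set: T] & g w = induced_label e edge_of_child v.
  exists (sigma^-1 w)%g; first by rewrite inE.
  by rewrite induced_label_child g_sigma permKV.
case=> [/eqP->|/gP[v _ ->]]; last by rewrite -gE.
by rewrite -gr.
Qed.

End RootedTree.

(** * The caterpillar rooted at the middle of its spine *)

Theorem theorem1 (T : finType) (e : rel T)
  (e_sym : symmetric e) (e_irr : irreflexive e)
  (e_cat : caterpillar e) (e_diam : diameter e = 4)
  (e_even : ~~ odd #|edges e|) :
  super_edge_graceful e.
Proof.
have [c1 [c2 [c3 [uniq_c /and3P[e12 e23 ne13] nlE leaf_nbr]]]] :=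
  caterpillar_diam4 e_sym e_irr e_cat e_diam.
pose C := [:: c1; c2; c3].
have [c1_c2 c1_c3 c2_c3] : [/\ c1 != c2, c1 != c3 & c2 != c3].
  by move: uniq_c; rewrite /= !inE negb_or => /and3P[/andP[]].
pose par v := if v \in [:: c1; c3] then c2 else odflt c2 [pick u | e v u].
have par1 : par c1 = c2 by rewrite /par mem_head.
have par3 : par c3 = c2 by rewrite /par !inE eqxx orbT.
have leafE v : (v \in leaves e) = (v \notin C) by rewrite -nlE in_setC negbK.
have e_leaf v u : v \notin C -> e v u = (par v == u).
  move=> vC; have v_l : v \in leaves e by rewrite leafE.
  have -> : par v = odflt c2 [pick u | e v u].
    by rewrite /par ifN //; apply: contra vC; rewrite !inE => /orP[]->; rewrite ?orbT.
  case: pickP => [w vw /=|no_nbr]; last first.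
    by have [w _ vw] := leaf_nbr v v_l; rewrite no_nbr in vw.
  apply/idP/eqP=> [vu|<- //]; exact: leaf_nbr_inj v_l vw vu.
have parC v : v \notin C -> par v \in C.
  move=> vC; have [|u uC] := leaf_nbr v; first by rewrite leafE.
  by rewrite e_leaf // => /eqP->.
have par_spine v : v \in C -> v != c2 -> par v = c2.
  by rewrite !inE => /or3P[] /eqP->; rewrite ?eqxx.
have eE x y : e x y = (x != c2) && (par x == y) || (y != c2) && (par y == x).
  (* A leaf is nobody's parent, since parents lie on the spine; this rules out the second
     disjunct. *)
  have leaf_case a b : a \notin C ->
      e a b = (a != c2) && (par a == b) || (b != c2) && (par b == a).
    move=> aC; have a_c2 : a != c2.
      by apply: contraNneq aC => ->; rewrite !inE eqxx orbT.
    rewrite e_leaf // a_c2 /=; case: eqVneq => //= par_a.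
    apply/esym/negbTE/negP=> /andP[b_c2 /eqP par_b].
    have [bC|/parC] := boolP (b \in C); last by rewrite par_b (negPf aC).
    by rewrite -par_b (par_spine _ bC) ?eqxx in a_c2.
  have [xC|/leaf_case//] := boolP (x \in C).
  have [yC|/leaf_case] := boolP (y \in C); last by rewrite e_sym orbC.
  move: xC yC; rewrite !inE => /or3P[] /eqP-> /or3P[] /eqP->;
    by rewrite ?par1 ?par3 ?e_irr ?eqxx ?(e_sym c2 c1) ?(e_sym c3 c2)
      ?(e_sym c3 c1) ?e12 ?e23 ?(negPf ne13) ?(eq_sym c2 c1) ?(eq_sym c3 c2)
      ?(negPf c1_c2) ?(negPf c2_c3) ?andbF ?orbT.
have par_par v : v != c2 -> par v != c2 -> par (par v) != v.
  move=> vc2 pv; have vC : v \notin C.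
    by apply: contra pv => vC; rewrite par_spine.
  by rewrite (par_spine _ (parC v vC) pv) eq_sym.
pose L c := enum [pred u | (u \notin C) && (par u == c)].
have mem_L c u : (u \in L c) = (u \notin C) && (par u == c) by rewrite mem_enum.
have notC_L c u : u \in C -> u \notin L c by move=> uC; rewrite mem_L uC.
have L_disjoint c d : c != d -> ~~ has (mem (L c)) (L d).
  move=> cd; apply/hasPn=> u /=; rewrite !mem_L => /andP[-> /eqP->] /=.
  by rewrite eq_sym.
have uniq_L : uniq [:: c2, c1, c3 & L c1 ++ L c2 ++ L c3].
  rewrite !cons_uniq !cat_uniq !enum_uniq has_cat !in_cons !mem_cat !negb_or.
  rewrite !L_disjoint // !notC_L ?inE ?eqxx ?orbT //.
  by rewrite (eq_sym c2 c1) c1_c2 c2_c3 c1_c3.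
have mem_s v : (v \in [:: c1, c3 & L c1 ++ L c2 ++ L c3]) = (v != c2).
  have [vC|vC] := boolP (v \in C).
    rewrite !in_cons !mem_cat !(negPf (notC_L _ _ vC)) !orbF.
    move: vC; rewrite !inE => /or3P[] /eqP->; rewrite ?eqxx ?orbT ?c1_c2 //.
      by rewrite (eq_sym c2 c1) (negPf c1_c2) (negPf c2_c3).
    by rewrite eq_sym c2_c3.
  rewrite !in_cons !mem_cat !mem_L vC /=.
  have -> : v != c2 by apply: contraNneq vC => ->; rewrite !inE eqxx orbT.
  by have := parC v vC; rewrite !inE => /or3P[] ->; rewrite ?orbT.
have s_perm : perm_eq [:: c1, c3 & L c1 ++ L c2 ++ L c3] (enum (predC1 c2)).
  apply: uniq_perm; rewrite ?enum_uniq //; first by case/andP: uniq_L.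
  by move=> v; rewrite mem_s mem_enum.
(* There are as many edges as non-root vertices: the leaves together with [c1] and [c3]. *)
have L_even : ~~ odd (size (L c1 ++ L c2 ++ L c3)).
  have := perm_size s_perm; rewrite -cardE cardC1.
  rewrite -(card_edges eE par_par) => size_s; move: e_even; rewrite -size_s.
  by rewrite /= negbK.
have [s [sigma [s_perm' [sum1 sum3 sum2 sigma_id]]]] :=
  balanced_exists uniq_L L_even.
apply: (@rooted_super_edge_graceful _ _ _ _ eE par_par (position_label s) _
          s sigma) => //.
- by apply: position_label_out; rewrite (perm_mem s_perm') mem_s eqxx.
- exact: perm_trans s_perm' s_perm.
set g := position_label s in sum1 sum2 sum3 *.
have c2C : c2 \in C by rewrite !inE eqxx orbT.
have notC_c2 u : u \notin C -> u != c2 by apply: contraNneq => ->.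
(* All children of an end of the spine are leaves, since [c1] and [c3] have parent [c2]. *)
have end_sum c : c != c2 ->
    (\sum_(u | (u != c2) && (par u == c)) g u = \sum_(u <- L c) g u)%R.
  move=> cc2; rewrite big_enum; apply: eq_bigl => u; rewrite inE /=.
  have [uC|/notC_c2->//] := boolP (u \in C).
  by apply/negP=> /andP[/(par_spine _ uC)->]; rewrite eq_sym (negPf cc2).
move=> v; have [vC|vC] := boolP (v \in C); last first.
  rewrite big_pred0 ?addr0 ?sigma_id // => [|u].
    by move: vC; rewrite !inE orbCA.
  apply/negP=> /andP[uc2 /eqP par_u]; move: vC; rewrite -par_u.
  by have [uC|/parC->//] := boolP (u \in C); rewrite (par_spine u uC uc2) c2C.
move: vC; rewrite !inE => /or3P[] /eqP->.
- by rewrite end_sum.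
- rewrite -sum2 [g c2]position_label_out ?add0r; last first.
    by rewrite (perm_mem s_perm') mem_s eqxx.
  (* The children of [c2] are [c1], [c3] and the leaves in [L c2]; the first two are split off. *)
  rewrite (bigD1 c1) ?par1 ?c1_c2 ?eqxx //=.
  rewrite (bigD1 c3) ?par3 ?eqxx ?andbT /=; last first.
    by rewrite eq_sym c2_c3 eq_sym c1_c3.
  rewrite addrA; congr (_ + _)%R; rewrite big_enum; apply: eq_bigl => u.
  rewrite !inE !negb_or.
  by case: (u == c1); case: (u == c2); case: (u == c3); case: (par u == c2).
- by rewrite end_sum // eq_sym.
Qed.
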